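(* Let $\mathcal{S}_n$ be the number of triangles having exactly one side in common with the perimeter of $P_n$ in a uniformly random triangulation $\mathcal{T}_n$ of a convex $n$-gon $P_n$, and let $g_n(z)=\mathbb{E}(z^{\mathcal{S}_n})$. Then: (I) For all $n\ge 4$, $$g_n(z)=\frac{1}{C_{n-2}}\sum_{j=0}^{n-2}C_j\left[2\binom{j+2}{n-2-j}-\binom{j+1}{n-2-j}\right]z^{2j+4-n}(1-z^2)^{n-2-j}.$$ (II) For all $n\ge 4$, $\mathbb{E}(\mathcal{S}_n)=\dfrac{n(n-4)}{2n-5}$. (III) For all $n\ge 5$, $\mathrm{Var}(\mathcal{S}_n)=\dfrac{2n(n-1)(n-4)(n-5)}{(2n-5)^2(2n-7)}$.
   Context: $P_n$ has vertices $v_{n,1},\dots,v_{n,n}$ in clockwise order. A triangulation of $P_n$ is a set of $n-3$ noncrossing diagonals partitioning $P_n$ into $n-2$ triangles; there are $C_{n-2}$ of them, where $C_k=\frac{1}{k+1}\binom{2k}{k}$, and $\mathcal{T}_n$ is chosen uniformly among them. Equivalently $\mathcal{S}_n=\sum_{\Delta\in\mathcal{T}_n}f_n(\Delta)$, where for $1\le l<j<r\le n$ the weight $f_{n,l,j,r}$ of the triangle with vertices $v_{n,l},v_{n,j},v_{n,r}$ is $1$ in each of the following cases and $0$ otherwise: $l>1$, $j=l+1$, $j+1<r\le n$; $l>1$, $j>l+1$, $r=j+1\le n$; $l=1$, $r=n$, $2<j<n-1$; $l=1$, $j=2$, $3<r<n$; $l=1$, $j>2$, $r=j+1<n$. Here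 $z$ is a complex variable, $\binom{a}{b}=0$ when $b>a\geq 0$, and terms with zero coefficient are taken to be $0$ (the terms with a negative exponent of $z$ all have zero coefficient). *)

(* Defs.v *)
From mathcomp Require Import all_boot all_order all_algebra.

Set Implicit Arguments.
Unset Strict Implicit.
Unset Printing Implicit Defensive.

Import GRing.Theory.

(* The vertices v_{n,1}, ..., v_{n,n} of the convex polygon are 0, ..., n-1 in *)
(* 'I_n, in clockwise order.  A chord is stored once, as its pair of endpoints *)
(* (a, b) with a < b; a triangle likewise as (l, j, r) with l < j < r.         *)

Definition chord (n : nat) := ('I_n * 'I_n)%type.

Definition is_side (n : nat) (e : chord n) : bool :=
  (e.2 == e.1.+1 :> nat) || (e.1 == 0 :> nat) && (e.2 == n.-1 :> nat).

Definition is_diagonal (n : nat) (e : chord n) : bool :=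
  (e.1 < e.2) && ~~ is_side e.

(* For vertices in convex position, the open chords e and f meet in a single   *)
(* point iff their endpoints strictly alternate around the polygon.            *)
Definition crossing (n : nat) (e f : chord n) : bool :=
  (e.1 < f.1 < e.2) && (e.2 < f.2) || (f.1 < e.1 < f.2) && (f.2 < e.2).

Definition noncrossing (n : nat) (D : {set chord n}) : bool :=
  [forall e in D, forall f in D, ~~ crossing e f].

Definition triangle (n : nat) := ('I_n * 'I_n * 'I_n)%type.

Definition edges (n : nat) (t : triangle n) : seq (chord n) :=
  let: (l, j, r) := t in [:: (l, j); (j, r); (l, r)].

(* The triangular regions cut out by a noncrossing set D of diagonals.  All    *)
(* vertices lie on the boundary of the polygon, so a diagonal entering the     *)
(* interior of a triangle crosses one of its edges; hence a triangle is a      *)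
(* region as soon as its three edges are sides of the polygon or lie in D.     *)
Definition triangles (n : nat) (D : {set chord n}) : {set triangle n} :=
  [set t : triangle n |
    (t.1.1 < t.1.2 < t.2) && all (fun e => is_side e || (e \in D)) (edges t)].

Definition triangulations (n : nat) : {set {set chord n}} :=
  [set D : {set chord n} |
    [&& [forall e in D, is_diagonal e], noncrossing D,
        #|D| == n - 3 & #|triangles D| == n - 2]].

Definition one_side_triangles (n : nat) (D : {set chord n}) : nat :=
  #|[set t in triangles D | count (@is_side n) (edges t) == 1]|.

Local Open Scope ring_scope.

(* Expectation and variance of X(T) for T uniform on the finite set A.         *)
Definition expect (F : fieldType) (T : finType) (A : {set T}) (X : T -> F) : F :=
  (\sum_(t in A) X t) / #|A|%:R.

Definition variance (F : fieldType) (T : finType) (A : {set T}) (X : T -> F) : F :=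
  expect A (fun t => (X t - expect A X) ^+ 2).

Definition S_pgf (F : fieldType) (n : nat) (z : F) : F :=
  expect (triangulations n) (fun D => z ^+ one_side_triangles D).

Definition S_mean (F : fieldType) (n : nat) : F :=
  expect (triangulations n) (fun D => (one_side_triangles D)%:R).

Definition S_variance (F : fieldType) (n : nat) : F :=
  variance (triangulations n) (fun D => (one_side_triangles D)%:R).

Definition catalan (F : fieldType) (k : nat) : F :=
  'C(2 * k, k)%:R / k.+1%:R.

(* Main.v *)
From HB Require Import structures.
Require Import Defs.
From mathcomp Require Import all_boot all_order all_algebra.
From mathcomp Require Import zify ring.
From mathcomp Require Import reals.
From mathcomp Require Import complex.

(** By recursion on the triangle at the side [v_1 v_n], triangulations of the
    n-gon correspond to binary trees with n - 2 nodes; a non-root node gives a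
    triangle with one side on the perimeter iff exactly one of its children is
    a leaf, and the root iff neither child is.  If a leaf is given weight z
    rather than 1, the generating function U(w) of trees by the number of nodes
    with exactly one leaf child satisfies w U^2 - U + z + (1 - z^2) w = 0, hence
    U = sum_j C_j w^j (z + (1 - z^2) w)^(j+1), and the probability generating
    function is (z U_k + 2 (1 - z^2) U_(k-1)) / C_k with k = n - 2.  The first
    two moments come from its derivatives at z = 1, where only the terms
    j = k, k - 1, k - 2 survive. *)

Import Order.TTheory GRing.Theory Num.Theory.
Local Open Scope ring_scope.

(** * Binary trees and their enumeration by number of nodes *)

Inductive tree := Leaf | Node of tree & tree.

Lemma tree_comparable : comparable tree.
Proof. by move=> s t; rewrite /decidable; decide equality. Qed.

HB.instance Definition _ := hasDecEq.Build tree (compareP tree_comparable).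

Fixpoint leaves (t : tree) : nat :=
  if t is Node l r then (leaves l + leaves r)%N else 1%N.

Definition is_leaf (t : tree) : bool := if t is Leaf then true else false.

(** A tree is laid out on consecutive vertices starting at [a]: a leaf is a unit chord, and a
    subtree is the chord spanning its leaves. *)
Fixpoint arcs (a : nat) (t : tree) : seq (nat * nat) :=
  (a, a + leaves t)%N ::
  if t is Node l r then arcs a l ++ arcs (a + leaves l)%N r else [::].

Fixpoint nodes (a : nat) (t : tree) : seq (nat * nat * nat) :=
  if t is Node l r then
    (a, a + leaves l, a + leaves l + leaves r)%N ::
    nodes a l ++ nodes (a + leaves l)%N r
  else [::].

Fixpoint half_leaf_nodes (t : tree) : nat :=
  if t is Node l r then
    ((is_leaf l (+) is_leaf r) + (half_leaf_nodes l + half_leaf_nodes r))%N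
  else 0%N.

(** The root triangle already has the closing side [v_1 v_n], so it counts only when neither of its
    other two edges is a side. *)
Definition one_side_nodes (t : tree) : nat :=
  if t is Node l r then
    (~~ (is_leaf l || is_leaf r) +
     (half_leaf_nodes l + half_leaf_nodes r))%N
  else 0%N.

(** The sizes [i] and [k' - i] of the two children are not structurally smaller than [k], so the
    recursion runs on the fuel [f]; any fuel above [k] gives the same list. *)
Fixpoint trees_fuel (f k : nat) : seq tree :=
  if f is f'.+1 then
    if k is k'.+1 then
      flatten [seq allpairs Node (trees_fuel f' i) (trees_fuel f' (k' - i)%N)
              | i <- iota 0 k]
    else [:: Leaf]
  else [::].

Definition trees (k : nat) : seq tree := trees_fuel k.+1 k.

Lemma trees_fuelS (f k : nat) : trees_fuel f.+1 k.+1 =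
  flatten [seq allpairs Node (trees_fuel f i) (trees_fuel f (k - i)%N)
          | i <- iota 0 k.+1].
Proof. by []. Qed.

Lemma trees_fuelE (f g k : nat) : (k < f)%N -> (k < g)%N ->
  trees_fuel f k = trees_fuel g k.
Proof.
elim: f g k => [|f IH] [|g] [|k] // kf kg.
have IHs i : (i <= k)%N -> trees_fuel f i = trees_fuel g i.
  by move=> ik; apply: IH; lia.
rewrite !trees_fuelS; congr flatten.
apply/eq_in_map => i; rewrite mem_iota => ik.
by rewrite !IHs //; lia.
Qed.

Lemma treesS (k : nat) :
  trees k.+1 = flatten [seq allpairs Node (trees i) (trees (k - i)%N)
                       | i <- iota 0 k.+1].
Proof.
rewrite {1}/trees trees_fuelS; congr flatten.
apply/eq_in_map => i; rewrite mem_iota => ik.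
by congr allpairs; apply: trees_fuelE; lia.
Qed.

Lemma leaves_gt0 (t : tree) : (0 < leaves t)%N.
Proof. by elim: t => //= l + r; lia. Qed.

Lemma leaves_eq1 (t : tree) : (leaves t == 1%N) = is_leaf t.
Proof. by case: t => //= l r; have := leaves_gt0 l; have := leaves_gt0 r; lia. Qed.

Lemma mem_trees (k : nat) (t : tree) : (t \in trees k) = (leaves t == k.+1).
Proof.
elim/ltn_ind: k t => -[|k] IH t.
  case: t => [|l r]; first by rewrite inE eqxx.
  have := leaves_gt0 l; have := leaves_gt0 r => r0 l0.
  by rewrite mem_seq1; apply/eqP/idP => //=; lia.
rewrite treesS; apply/flatten_mapP/idP.
  case=> i; rewrite mem_iota => ik /allpairsP; case=> -[l r] /= [].
  by rewrite !IH; [|lia..] => /eqP lE /eqP rE -> /=; lia.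
case: t => [|l r] //= /eqP lr.
have := leaves_gt0 l; have := leaves_gt0 r => r0 l0.
exists (leaves l).-1; first by rewrite (mem_iota 0 k.+1); lia.
by apply: allpairs_f; rewrite IH; lia.
Qed.

Lemma uniq_trees (k : nat) : uniq (trees k).
Proof.
elim/ltn_ind: k => -[|k] IH //.
rewrite treesS.
(* The induction is over an arbitrary duplicate-free list of indices below [k.+1]. Blocks of
   different indices are disjoint because the left child determines the index. *)
have : {subset iota 0 k.+1 <= gtn k.+1} by move=> i; rewrite mem_iota inE; lia.
elim: (iota 0 k.+1) (iota_uniq 0 k.+1) => //= i s IHs /andP[i_s us] sk.
have ik : (i < k.+1)%N by apply: sk; rewrite inE eqxx.
rewrite cat_uniq IHs // ?andbT; last by move=> j js; apply: sk; rewrite inE js orbT.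
rewrite allpairs_uniq ?IH //=; [|lia|by move=> [? ?] [? ?] _ _ [-> ->]].
apply/hasPn => t /flatten_mapP[j js /allpairsP].
case=> -[l r] /= [+ _ ->].
rewrite mem_trees => lj; apply/negP => /allpairsP; case=> -[l' r'] /= [+ _ [lE _]].
rewrite -lE mem_trees (eqP lj) => /eqP[ji].
by rewrite -ji js in i_s.
Qed.

Lemma sum_treesS (V : nmodType) (k : nat) (F : tree -> V) :
  \sum_(t <- trees k.+1) F t =
  \sum_(i < k.+1) \sum_(l <- trees i) \sum_(r <- trees (k - i)%N) F (Node l r).
Proof.
rewrite treesS big_flatten big_map.
rewrite -[iota _ _]/(index_iota 0 k.+1) big_mkord.
by apply: eq_bigr => i _; rewrite big_allpairs_dep.
Qed.

(** * Chords and triangles read off a tree *)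

Lemma arcs_bounds (a : nat) (t : tree) (p : nat * nat) :
  p \in arcs a t -> (a <= p.1 < p.2)%N && (p.2 <= a + leaves t)%N.
Proof.
elim: t a => [|l IHl r IHr] a /=; rewrite inE.
  by move/eqP=> -> /=; lia.
have := leaves_gt0 l; have := leaves_gt0 r => r0 l0.
case/orP => [/eqP -> /=|]; first lia.
by rewrite mem_cat => /orP[/IHl | /IHr]; lia.
Qed.

Lemma arcs_root (a : nat) (t : tree) : (a, a + leaves t)%N \in arcs a t.
Proof. by case: t => *; rewrite inE eqxx. Qed.

Lemma arcs_unit (a : nat) (t : tree) (x : nat) :
  (a <= x < a + leaves t)%N -> (x, x.+1) \in arcs a t.
Proof.
elim: t a => [|l IHl r IHr] a /= axb.
  by rewrite inE xpair_eqE; lia.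
rewrite inE mem_cat; apply/orP; right.
by have [xl|lx] := ltnP x (a + leaves l)%N; [rewrite IHl|rewrite IHr ?orbT]; lia.
Qed.

(** Arcs of the same child do not cross by induction; those of different children lie in intervals
    sharing only an endpoint, and the root arc contains them all. *)
Lemma arcs_laminar (a : nat) (t : tree) (p q : nat * nat) :
  p \in arcs a t -> q \in arcs a t -> ~~ ((p.1 < q.1 < p.2)%N && (p.2 < q.2)%N).
Proof.
move=> pt qt; have := arcs_bounds _ _ _ pt; have := arcs_bounds _ _ _ qt.
elim: t a pt qt => [|l IHl r IHr] a /=; first by lia.
rewrite !inE => /orP[/eqP -> /=|+]; first by lia.
move=> + /orP[/eqP -> /=|+]; first by lia.
rewrite !mem_cat => /orP[pl|pr] /orP[ql|qr] _ _.
- exact: IHl (arcs_bounds _ _ _ ql) (arcs_bounds _ _ _ pl).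
- by have := arcs_bounds _ _ _ pl; have := arcs_bounds _ _ _ qr; lia.
- by have := arcs_bounds _ _ _ pr; have := arcs_bounds _ _ _ ql; lia.
- exact: IHr (arcs_bounds _ _ _ qr) (arcs_bounds _ _ _ pr).
Qed.

Lemma uniq_arcs (a : nat) (t : tree) : uniq (arcs a t).
Proof.
elim: t a => [|l IHl r IHr] a //=.
have := leaves_gt0 l; have := leaves_gt0 r => r0 l0.
rewrite mem_cat cat_uniq IHl IHr andbT /=; apply/andP; split.
  by apply/negP => /orP[] /arcs_bounds /=; lia.
apply/hasPn => p pr; apply/negP => pl.
by have := arcs_bounds _ _ _ pl; have := arcs_bounds _ _ _ pr; lia.
Qed.

(** Long arcs belong to the inner nodes, and a binary tree has one inner node fewer than leaves. *)
Lemma count_long_arcs (a : nat) (t : tree) :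
  (count (fun p : nat * nat => p.2 != p.1.+1) (arcs a t)).+1 = leaves t.
Proof.
elim: t a => [|l IHl r IHr] a /=; first by rewrite addn1 eqxx.
have := leaves_gt0 l; have := leaves_gt0 r => r0 l0.
by have := IHl a; have := IHr (a + leaves l)%N; rewrite count_cat; lia.
Qed.

Lemma arcs_Node_left (a : nat) (l r : tree) (p : nat * nat) :
  (p.2 <= a + leaves l)%N -> (p \in arcs a (Node l r)) -> p \in arcs a l.
Proof.
rewrite inE mem_cat => pl /or3P[/eqP pE|//|/arcs_bounds].
  by have := leaves_gt0 r; rewrite pE /= in pl *; lia.
by lia.
Qed.

Lemma arcs_Node_right (a : nat) (l r : tree) (p : nat * nat) :
  (a + leaves l <= p.1)%N -> p \in arcs a (Node l r) ->
  p \in arcs (a + leaves l)%N r.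
Proof.
rewrite inE mem_cat => pl /or3P[/eqP pE|/arcs_bounds|//].
  by have := leaves_gt0 l; rewrite pE /= in pl *; lia.
by lia.
Qed.

Lemma mem_arcs_left (a : nat) (l r : tree) (p : nat * nat) :
  p \in arcs a l -> p \in arcs a (Node l r).
Proof. by move=> pl; rewrite inE mem_cat pl orbT. Qed.

Lemma mem_arcs_right (a : nat) (l r : tree) (p : nat * nat) :
  p \in arcs (a + leaves l)%N r -> p \in arcs a (Node l r).
Proof. by move=> pl; rewrite inE mem_cat pl !orbT. Qed.

(** If the two roots split at different vertices, the left child arc of one tree crosses the right
    child arc of the other. So the splits agree, and the inclusion of arcs restricts to both
    children. *)
Lemma arcs_inj (a : nat) (s t : tree) : leaves s = leaves t ->
  {subset arcs a s <= arcs a t} -> s = t.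
Proof.
elim: s a t => [|l IHl r IHr] a [|l' r'] st sub //.
- by have := leaves_gt0 l'; have := leaves_gt0 r'; move: st => /=; lia.
- by have := leaves_gt0 l; have := leaves_gt0 r; move: st => /=; lia.
have inl := mem_arcs_left a l r _ (arcs_root _ _).
have inr := mem_arcs_right a l r _ (arcs_root _ _).
have inl' := mem_arcs_left a l' r' _ (arcs_root _ _).
have inr' := mem_arcs_right a l' r' _ (arcs_root _ _).
have lam1 := arcs_laminar _ _ _ _ inl' (sub _ inr).
have lam2 := arcs_laminar _ _ _ _ (sub _ inl) inr'.
have := leaves_gt0 l; have := leaves_gt0 r.
have := leaves_gt0 l'; have := leaves_gt0 r' => r'0 l'0 r0 l0.
move: st lam1 lam2 => /= st lam1 lam2.
have ll : leaves l = leaves l' by lia.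
have rr : leaves r = leaves r' by lia.
congr Node.
  apply: (IHl a l' ll) => p pin; apply: (@arcs_Node_left a l' r').
    by rewrite -ll; have /andP[_] := arcs_bounds _ _ _ pin.
  exact/sub/mem_arcs_left.
apply: (IHr (a + leaves l)%N r' rr) => p pin; rewrite ll.
apply: (@arcs_Node_right a l' r'); last first.
  exact/sub/mem_arcs_right.
by rewrite -ll; have /andP[/andP[]] := arcs_bounds _ _ _ pin.
Qed.

Lemma nodes_arcs (a : nat) (t : tree) (l j r : nat) : (l, j, r) \in nodes a t ->
  [/\ (l < j < r)%N, (l, j) \in arcs a t, (j, r) \in arcs a t
    & (l, r) \in arcs a t].
Proof.
elim: t a => [|tl IHl tr IHr] a //; rewrite [nodes _ _]/= in_cons mem_cat.
case/or3P => [/eqP[-> -> ->]|/IHl[? ? ? ?]|/IHr[? ? ? ?]].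
- split; first by have := leaves_gt0 tl; have := leaves_gt0 tr; lia.
  + by apply: mem_arcs_left; apply: arcs_root.
  + by apply: mem_arcs_right; apply: arcs_root.
  + by rewrite -addnA; apply: (arcs_root a (Node tl tr)).
- by split=> //; apply: mem_arcs_left.
- by split=> //; apply: mem_arcs_right.
Qed.

Lemma nodes_bounds (a : nat) (t : tree) (l j r : nat) : (l, j, r) \in nodes a t ->
  [/\ (a <= l)%N, (l < j)%N, (j < r)%N & (r <= a + leaves t)%N].
Proof.
case/nodes_arcs => ljr /arcs_bounds /= ? /arcs_bounds /= ? /arcs_bounds /= ?.
by split; lia.
Qed.

Lemma uniq_nodes (a : nat) (t : tree) : uniq (nodes a t).
Proof.
elim: t a => [|l IHl r IHr] a //=.
have := leaves_gt0 l; have := leaves_gt0 r => r0 l0.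
rewrite mem_cat cat_uniq IHl IHr andbT /=; apply/andP; split.
  by apply/negP => /orP[] /nodes_bounds[]; lia.
apply/hasPn => -[[x y] v] /nodes_bounds[? ? ? ?]; apply/negP => /nodes_bounds[].
by lia.
Qed.

Lemma size_nodes (a : nat) (t : tree) : (size (nodes a t)).+1 = leaves t.
Proof.
elim: t a => //= l IHl r IHr a.
by have := IHl a; have := IHr (a + leaves l)%N; rewrite size_cat; lia.
 Qed.

(** * Passage from pairs and triples of numbers to chords and triangles *)

Lemma card_preim_seq (T : finType) (U : eqType) (f : T -> U) (s : seq U) :
  injective f -> uniq s -> {subset s <= codom f} ->
  #|[set x | f x \in s]| = size s.
Proof.
move=> f_inj us sf; rewrite cardE -(size_map f); apply: perm_size.
apply: uniq_perm => //; first by rewrite map_inj_uniq ?enum_uniq.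
move=> y; apply/mapP/idP => [[x + ->]|ys].
  by rewrite mem_enum inE.
have /codomP[x yE] := sf y ys.
by exists x; rewrite // mem_enum inE -yE.
Qed.

Definition nat_chord {n : nat} (e : chord n) : nat * nat :=
  (nat_of_ord e.1, nat_of_ord e.2).

Definition nat_triangle {n : nat} (t : triangle n) : nat * nat * nat :=
  (nat_of_ord t.1.1, nat_of_ord t.1.2, nat_of_ord t.2).

Lemma nat_chord_inj (n : nat) : injective (@nat_chord n).
Proof. by move=> [x y] [x' y'] [/val_inj -> /val_inj ->]. Qed.

Lemma nat_triangle_inj (n : nat) : injective (@nat_triangle n).
Proof. by move=> [[x y] v] [[x' y'] v'] [/val_inj -> /val_inj -> /val_inj ->]. Qed.

Lemma nat_chord_codom (n : nat) (p : nat * nat) :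
  (p.1 < n)%N -> (p.2 < n)%N -> p \in codom (@nat_chord n).
Proof.
by case: p => x y /= xn yn; apply/codomP; exists (Ordinal xn, Ordinal yn).
Qed.

Lemma nat_triangle_codom (n x y v : nat) :
  (x < n)%N -> (y < n)%N -> (v < n)%N -> (x, y, v) \in codom (@nat_triangle n).
Proof.
by move=> xn yn vn; apply/codomP; exists (Ordinal xn, Ordinal yn, Ordinal vn).
Qed.

Definition tree_diagonals (n : nat) (t : tree) : {set chord n} :=
  [set e | is_diagonal e && (nat_chord e \in arcs 0 t)].

(** * Bijection between trees and triangulations *)

Section Triangulation.
(** The polygon has [w.+1] vertices; the [w] sides other than [root] are the leaves of the tree. *)
Variable w : nat.
Hypothesis w_gt1 : (1 < w)%N.

Let root : chord w.+1 := (ord0, ord_max).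

(** Every side is an arc: the unit sides occur at the leaves, the closing side at the root. *)
Lemma side_or_diagonal (t : tree) (e : chord w.+1) :
  leaves t = w -> (e.1 < e.2)%N ->
  is_side e || (e \in tree_diagonals w.+1 t) = (nat_chord e \in arcs 0 t).
Proof.
move=> tw e12; rewrite inE /is_diagonal e12 /=.
case: (boolP (is_side e)) => //=; rewrite /is_side /nat_chord.
case: e e12 => -[x xw] [y yw] /= xy /orP[/eqP ->|/andP[/eqP -> /eqP ->]].
  by rewrite arcs_unit // tw; lia.
by have := arcs_root 0 t; rewrite add0n tw => ->.
Qed.

Lemma noncrossing_tree (t : tree) : noncrossing (tree_diagonals w.+1 t).
Proof.
apply/'forall_implyP => e; rewrite inE => /andP[_ et].
apply/'forall_implyP => f; rewrite inE => /andP[_ ft].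
rewrite /crossing negb_or; apply/andP; split.
  exact: arcs_laminar et ft.
exact: arcs_laminar ft et.
Qed.

Lemma card_tree_diagonals (t : tree) :
  leaves t = w -> #|tree_diagonals w.+1 t| = (w - 2)%N.
Proof.
(* The diagonals are the [w - 1] long arcs without the root arc [(0, w)]. *)
move=> tw; pose P (p : nat * nat) := (p.2 != p.1.+1) && (p != (0, w)%N).
have -> : tree_diagonals w.+1 t =
    [set e | nat_chord e \in filter P (arcs 0 t)].
  apply/setP => e; rewrite !inE mem_filter.
  case et: (nat_chord e \in arcs 0 t); rewrite ?andbF ?andbT //.
  have /= := arcs_bounds _ _ _ et; rewrite tw /is_diagonal /is_side /P xpair_eqE /=.
  by lia.
rewrite card_preim_seq; [|exact: nat_chord_inj|exact/filter_uniq/uniq_arcs|].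
- rewrite size_filter; have := count_long_arcs 0 t; have := uniq_arcs 0 t.
  case: t tw => [|l r] /= tw; first by lia.
  rewrite !add0n tw => /andP[root_notin _] /=.
  have -> : count P (arcs 0 l ++ arcs (leaves l) r) =
      count (fun p : nat * nat => p.2 != p.1.+1) (arcs 0 l ++ arcs (leaves l) r).
    apply: eq_in_count => p pin; rewrite /P.
    case: (p =P _) => [pE|]; rewrite ?andbT //.
    by rewrite -pE pin in root_notin.
  by rewrite /P eqxx andbF /=; lia.
- move=> p; rewrite mem_filter => /andP[_ /arcs_bounds]; rewrite tw => pb.
  by apply: nat_chord_codom; lia.
Qed.

(** For two triangles on the base [(l, r)] with apexes [j < j'], the edges [(l, j')] and [(j, r)]
    cross; neither is a side, so both lie in [D]. *)
Lemma triangle_apex_inj (D : {set chord w.+1}) : noncrossing D ->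
  {in triangles D &, injective (fun t : triangle w.+1 => (t.1.1, t.2))}.
Proof.
move=> /'forall_implyP ncD.
suff no_lt (l j r j' : 'I_w.+1) : (l, j, r) \in triangles D ->
    (l, j', r) \in triangles D -> ~ (j < j')%N.
  move=> [[l j] r] [[l' j'] r'] tD tD' [lE rE]; subst l' r'.
  have [jj'|j'j|/val_inj -> //] := ltngtP j j'.
    by case: (no_lt l j r j').
  by case: (no_lt l j' r j).
rewrite !inE /= !andbT => /andP[/andP[lj jr] /and3P[_ jrD _]].
move=> /andP[/andP[lj' jr'] /and3P[lj'D _ _]] jj'.
have := ltn_ord r => rw.
case/orP: lj'D => [|lj'D]; first by rewrite /is_side /=; lia.
case/orP: jrD => [|jrD]; first by rewrite /is_side /=; lia.
have /'forall_implyP/(_ _ jrD) := ncD _ lj'D.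
by rewrite /crossing /=; lia.
Qed.

Lemma triangles_bases (D : {set chord w.+1}) :
  [set (t.1.1, t.2) | t in triangles D] \subset root |: D.
Proof.
apply/subsetP => e /imsetP[[[l j] r] + ->]; rewrite inE /=.
case/and4P => /andP[lj jr] _ _; rewrite andbT in_setU1.
have rw := ltn_ord r.
case/orP => [|->]; last by rewrite orbT.
rewrite /is_side /= => /orP[|/andP[/eqP l0 /eqP rE]]; first by lia.
by apply/orP; left; apply/eqP; congr pair; apply: val_inj.
Qed.

Lemma card_triangles_le (D : {set chord w.+1}) :
  noncrossing D -> (#|triangles D| <= #|D|.+1)%N.
Proof.
move=> ncD; rewrite -(card_in_imset (triangle_apex_inj D ncD)).
apply: leq_trans (subset_leq_card (triangles_bases D)) _.
by rewrite cardsU1 -[X in (_ <= X)%N]add1n leq_add2r; case: (_ \notin _).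
Qed.

(** The nodes yield [w - 1] triangles, which is already the maximum allowed by [w - 2] noncrossing
    diagonals, so there are no others. *)
Lemma triangles_tree (t : tree) : leaves t = w ->
  triangles (tree_diagonals w.+1 t) = [set d | nat_triangle d \in nodes 0 t].
Proof.
move=> tw; apply/esym/eqP; rewrite eqEcard; apply/andP; split.
  apply/subsetP => -[[l j] r]; rewrite inE => /nodes_arcs[/andP[lj jr] lj_t jr_t lr_t].
  by rewrite inE /= lj jr !side_or_diagonal // ?(ltn_trans lj) // lj_t jr_t lr_t.
apply: leq_trans (card_triangles_le _ (noncrossing_tree t)) _.
rewrite card_tree_diagonals // card_preim_seq ?uniq_nodes //.
- by rewrite -ltnS size_nodes tw; lia.
- exact: nat_triangle_inj.
- move=> [[l j] r] /nodes_bounds[]; rewrite tw => *.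
  by apply: nat_triangle_codom; lia.
Qed.

Lemma tree_diagonals_in (t : tree) :
  leaves t = w -> tree_diagonals w.+1 t \in triangulations w.+1.
Proof.
move=> tw; rewrite inE noncrossing_tree card_tree_diagonals //; apply/and4P; split.
- by apply/'forall_implyP => e; rewrite inE => /andP[].
- by [].
- by apply/eqP; lia.
- rewrite triangles_tree // card_preim_seq ?uniq_nodes //.
  + by rewrite -eqSS size_nodes tw; lia.
  + exact: nat_triangle_inj.
  + move=> [[l j] r] /nodes_bounds[]; rewrite tw => *.
    by apply: nat_triangle_codom; lia.
Qed.

Lemma tree_diagonals_inj (s t : tree) : leaves s = w -> leaves t = w ->
  tree_diagonals w.+1 s = tree_diagonals w.+1 t -> s = t.
Proof.
move=> sw tw st; apply: (arcs_inj 0); first by rewrite sw.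
move=> p pin; have := arcs_bounds _ _ _ pin; rewrite sw => pb.
have /codomP[e pE] : p \in codom (@nat_chord w.+1) by apply: nat_chord_codom; lia.
have e12 : (e.1 < e.2)%N by move: pb; rewrite pE /=; lia.
by rewrite pE -side_or_diagonal // -st side_or_diagonal // -pE.
Qed.

(* The injection of triangles into bases becomes a bijection by cardinality, so
   every diagonal and the root side is the base of a triangle. *)
Lemma triangulation_tree (D : {set chord w.+1}) : D \in triangulations w.+1 ->
  exists2 t, leaves t = w & tree_diagonals w.+1 t = D.
Proof.
rewrite inE => /and4P[/'forall_implyP diagD ncD /eqP cardD /eqP cardT].
have bases : [set (t.1.1, t.2) | t in triangles D] = root |: D.
  apply/eqP; rewrite eqEcard triangles_bases (card_in_imset (triangle_apex_inj D ncD)).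
  rewrite cardT cardsU1 cardD; case: (_ \notin _); lia.
(* Strong induction on the span of [e]: a unit chord gives a leaf, and any other is the base of a
   triangle whose two remaining edges are shorter chords of the same kind. *)
have build (e : chord w.+1) : (e.1 < e.2)%N -> is_side e || (e \in D) ->
    exists2 t, leaves t = (e.2 - e.1)%N &
      forall f : chord w.+1, nat_chord f \in arcs e.1 t -> is_side f || (f \in D).
  have [k] := ubnP (e.2 - e.1)%N; elim: k e => // k IH e ek e12 eD.
  have [e_unit|e_long] := boolP (e.2 == e.1.+1 :> nat).
    exists Leaf; first by rewrite (eqP e_unit) subSnn.
    move=> f; rewrite mem_seq1 => /eqP[f1 f2].
    by rewrite /is_side f1 f2 addn1 eqxx.
  have : e \in root |: D.
    rewrite in_setU1; case/orP: eD => [|->]; last by rewrite orbT.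
    rewrite /is_side (negPf e_long) /= => /andP[/eqP e1 /eqP e2].
    case: (e) e1 e2 => x y /= e1 e2; apply/orP; left; apply/eqP.
    by congr pair; apply: val_inj.
  rewrite -bases => /imsetP[[[l j] r]] + eE; rewrite eE /= in ek e12 eD *.
  rewrite inE /= andbT => /and4P[/andP[lj jr] ljD jrD _].
  have jl_k : (j - l < k)%N by lia.
  have rj_k : (r - j < k)%N by lia.
  have [s ls sD] := IH (l, j) jl_k lj ljD.
  have [t lt tD] := IH (j, r) rj_k jr jrD.
  rewrite /= in ls lt sD tD.
  exists (Node s t) => [|f]; first by rewrite /= ls lt; lia.
  rewrite inE mem_cat ls subnKC 1?ltnW // => /or3P[/eqP[f1 f2]|/sD//|/tD//].
  suff -> : f = (l, r) by [].
  by apply: nat_chord_inj; rewrite /nat_chord f1 f2 /= ls lt; congr pair; lia.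
have [||t tw tD] := build root.
- by rewrite /=; lia.
- by rewrite /is_side /= eqxx orbT.
exists t; first by rewrite tw /= subn0.
(* The diagonals of the tree lie in [D], and both sets have [w - 2] elements. *)
apply/eqP; rewrite eqEcard card_tree_diagonals ?tw /= ?subn0 // cardD.
apply/andP; split; last by lia.
apply/subsetP => e; rewrite inE => /andP[/andP[_ /negPf e_side] /tD].
by rewrite e_side.
Qed.

Lemma sum_triangulations (V : nmodType) (F : {set chord w.+1} -> V) :
  \sum_(D in triangulations w.+1) F D =
  \sum_(t <- trees w.-1) F (tree_diagonals w.+1 t).
Proof.
rewrite -(big_map (tree_diagonals w.+1) predT F) -big_enum.
apply: perm_big; apply: uniq_perm; first exact: enum_uniq.
- rewrite map_inj_in_uniq ?uniq_trees // => s t.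
  rewrite !mem_trees prednK ?(ltnW w_gt1) // => /eqP sw /eqP tw.
  exact: tree_diagonals_inj.
move=> D; rewrite mem_enum; apply/idP/mapP => [/triangulation_tree[t tw <-]|[t + ->]].
  by exists t => //; rewrite mem_trees tw prednK // ltnW.
by rewrite mem_trees prednK ?(ltnW w_gt1) // => /eqP tw; apply: tree_diagonals_in.
Qed.

(** * Perimeter sides counted on the tree *)

Let one_side (d : nat * nat * nat) : bool :=
  let side x y := (y == x.+1) || (x == 0)%N && (y == w) in
  (side d.1.1 d.1.2 + (side d.1.2 d.2 + side d.1.1 d.2) == 1)%N.

(** The hypothesis rules out the closing side, and the base of a node spans at least two leaves;
    hence only leaf children contribute sides. *)
Lemma count_one_side_subtree (a : nat) (t : tree) :
  (0 < a)%N || (a + leaves t < w)%N ->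
  count one_side (nodes a t) = half_leaf_nodes t.
Proof.
elim: t a => //= l IHl r IHr a aw.
have := leaves_gt0 l; have := leaves_gt0 r => r0 l0.
rewrite count_cat IHl ?IHr; [|lia..]; congr addn.
by rewrite -!leaves_eq1 /one_side /=; lia.
Qed.

Lemma one_side_triangles_tree (t : tree) : leaves t = w ->
  one_side_triangles (tree_diagonals w.+1 t) = one_side_nodes t.
Proof.
move=> tw; rewrite /one_side_triangles triangles_tree //.
have -> : [set d in [set d | nat_triangle d \in nodes 0 t] |
      count (@is_side w.+1) (edges d) == 1%N] =
    [set d | nat_triangle d \in filter one_side (nodes 0 t)].
  apply/setP => -[[l j] r]; rewrite !inE mem_filter andbC; congr andb.
  by rewrite /= addn0.
rewrite card_preim_seq ?filter_uniq ?uniq_nodes //; first last.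
- move=> [[l j] r]; rewrite mem_filter => /andP[_ /nodes_bounds[]].
  by rewrite tw => *; apply: nat_triangle_codom; lia.
- exact: nat_triangle_inj.
rewrite size_filter; case: t tw => //= l r tw.
have := leaves_gt0 l; have := leaves_gt0 r => r0 l0.
rewrite count_cat !count_one_side_subtree; [|lia..]; congr addn.
by rewrite -!leaves_eq1 /one_side /=; lia.
Qed.

End Triangulation.

(** * Generating function of the statistic over trees *)

Lemma sum_triangle (V : nmodType) (n : nat) (f : nat -> nat -> V) :
  \sum_(m < n) \sum_(i < m.+1) f i (m - i)%N =
  \sum_(i < n) \sum_(j < n - i) f i j.
Proof.
elim: n => [|n IH]; first by rewrite !big_ord0.
rewrite big_ord_recr IH /= [RHS]big_ord_recr /= subSnn big_ord1.
rewrite [X in _ + X]big_ord_recr /= subnn addrA -big_split /=; congr (_ + _).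
by apply: eq_bigr => i _; rewrite subSn ?big_ord_recr // ltnW.
Qed.

Section GeneratingFunction.
(** The ring is general so that [z] can be a number, for the generating function, or the
    indeterminate ['X], for its derivatives. *)
Variables (K : comNzRingType) (z : K).

(* The leaf weight [z] instead of [1] absorbs the linear term of the quadratic
   equation for the generating function by [half_leaf_nodes]. *)
Definition leaf_weight (t : tree) : K :=
  if t is Leaf then z else z ^+ half_leaf_nodes t.

#[local] Arguments leaf_weight : simpl never.

Let U (k : nat) : K := \sum_(t <- trees k) leaf_weight t.

(** A single leaf child supplies exactly the factor z due to its parent. Two leaf children supply
    z^2 where 1 is due, whence the correction. *)
Lemma weight_Node (l r : tree) :
  leaf_weight (Node l r) =
  leaf_weight l * leaf_weight r + (is_leaf l && is_leaf r)%:R * (1 - z ^+ 2).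
Proof.
by case: l r => [|l1 l2] [|r1 r2]; rewrite /leaf_weight /= ?exprD ?expr0 ?expr1; ring.
Qed.

(** With no leaf child the root contributes z. With one it contributes 1, written as z * z + (1 -
    z^2). *)
Lemma expr_one_side_nodes (l r : tree) : ~~ (is_leaf l && is_leaf r) ->
  z ^+ one_side_nodes (Node l r) =
  z * (leaf_weight l * leaf_weight r) +
  (1 - z ^+ 2) * ((is_leaf l)%:R * leaf_weight r + (is_leaf r)%:R * leaf_weight l).
Proof.
by case: l r => [|l1 l2] [|r1 r2] //= _; rewrite /leaf_weight ?exprD ?expr0 ?expr1; ring.
Qed.

Lemma is_leaf_trees (k : nat) (t : tree) : t \in trees k -> is_leaf t = (k == 0)%N.
Proof. by rewrite mem_trees -leaves_eq1 => /eqP ->. Qed.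

(** Coefficient form of U = z + w U^2 + (1 - z^2) w; the last term comes from the one-node tree. *)
Lemma weight_sumS (k : nat) :
  U k.+1 = \sum_(i < k.+1) U i * U (k - i)%N + (k == 0)%:R * (1 - z ^+ 2).
Proof.
rewrite /U sum_treesS; case: k => [|k].
  by rewrite !big_ord1 subn0 -[trees 0]/[:: Leaf] !big_seq1 weight_Node.
rewrite mul0r addr0; apply: eq_bigr => -[i ik] _ /=; rewrite big_distrlr /=.
rewrite big_seq [RHS]big_seq; apply: eq_bigr => l /is_leaf_trees lE.
rewrite big_seq [RHS]big_seq; apply: eq_bigr => r /is_leaf_trees rE.
rewrite weight_Node lE rE (_ : _ && _ = false) ?mul0r ?addr0 //.
by lia.
Qed.

(** With at least two nodes the root has at most one leaf child. This occurs at the two extreme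
    splits [i = 0] and [i = k.+1], and each adds (1 - z^2) U_(k+1). *)
Lemma one_side_sumS (k : nat) :
  \sum_(t <- trees k.+2) z ^+ one_side_nodes t =
  z * U k.+2 + 2 * (1 - z ^+ 2) * U k.+1.
Proof.
rewrite weight_sumS mul0r addr0 mulr_sumr sum_treesS.
transitivity (\sum_(i < k.+2) (z * (U i * U (k.+1 - i)%N) +
  (1 - z ^+ 2) * ((i == 0 :> nat)%:R * U k.+1 + (i == k.+1 :> nat)%:R * U k.+1))).
  apply: eq_bigr => -[i ik] _ /=; rewrite /U big_distrlr /= mulr_sumr.
  transitivity (\sum_(l <- trees i) \sum_(r <- trees (k.+1 - i)%N)
     (z * (leaf_weight l * leaf_weight r) + (1 - z ^+ 2) *
       ((i == 0)%:R * leaf_weight r + (i == k.+1)%:R * leaf_weight l))).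
    rewrite big_seq [RHS]big_seq; apply: eq_bigr => l /is_leaf_trees lE.
    rewrite big_seq [RHS]big_seq; apply: eq_bigr => r /is_leaf_trees rE.
    rewrite expr_one_side_nodes lE rE; last by lia.
    by rewrite (_ : (k.+1 - i == 0)%N = (i == k.+1)) //; lia.
  transitivity (\sum_(l <- trees i)
      (z * \sum_(r <- trees (k.+1 - i)%N) leaf_weight l * leaf_weight r +
       (1 - z ^+ 2) * \sum_(r <- trees (k.+1 - i)%N)
         ((i == 0)%:R * leaf_weight r + (i == k.+1)%:R * leaf_weight l))).
    by apply: eq_bigr => l _; rewrite big_split !mulr_sumr.
  rewrite big_split /= -!mulr_sumr; congr (_ + _ * _).
  have [->|i_n0] := eqVneq i 0%N.
    rewrite big_seq1 subn0 /= [in RHS]mul1r [in RHS]mul0r addr0.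
    by under eq_bigr do rewrite mul1r mul0r addr0.
  have [->|i_nk] := eqVneq i k.+1.
    rewrite [in RHS]mul0r add0r mul1r; apply: eq_bigr => l _.
    by rewrite subnn -[trees 0]/[:: Leaf] big_seq1 mul0r mul1r add0r.
  by rewrite big1 ?mul0r ?addr0 // => l _; rewrite big1 // => r _; rewrite !mul0r addr0.
rewrite big_split; congr (_ + _).
rewrite -mulr_sumr big_split /= -!mulr_suml [X in X * _ + _]big_ord_recl.
rewrite [X in _ + X * _]big_ord_recr /= eqxx !big1 => [|[i ik] _|//] /=.
  by ring.
by rewrite (_ : i == k.+1 = false) //; lia.
Qed.

Let c (j : nat) : K := (size (trees j))%:R.

Lemma size_treesS (k : nat) :
  size (trees k.+1) = (\sum_(i < k.+1) size (trees i) * size (trees (k - i)))%N.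
Proof.
rewrite -sum1_size sum_treesS; apply: eq_bigr => i _.
by rewrite -!sum1_size big_distrlr.
Qed.

(** The equation becomes w U^2 - U + q = 0, solved by U = q C(w q) with C the Catalan series; its
    terms are c_j w^j q^(j+1). *)
Let q : {poly K} := z%:P + (1 - z ^+ 2) *: 'X.

Lemma coef_binomial_exp (m i : nat) :
  (q ^+ m)`_i = 'C(m, i)%:R * z ^+ (m - i) * (1 - z ^+ 2) ^+ i.
Proof.
rewrite /q exprDn coef_sum; under eq_bigr => j _.
  rewrite -polyC_exp coefMn mul_polyC coefZ exprZn coefZ coefXn.
  over.
have [im|mi] := ltnP i m.+1; last first.
  rewrite bin_small // !mul0r big1 // => -[j jm] _ /=.
  by rewrite (_ : i == j = false) ?mulr0 ?mul0rn //; lia.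
rewrite (bigD1 (Ordinal im)) //= eqxx big1 ?addr0 => [|[j jm]].
  by rewrite mulr1 mulr_natl mulrnAl.
rewrite -val_eqE /= eq_sym => /negPf ->.
by rewrite !mulr0 mul0rn.
Qed.

Let E (j k : nat) : K := ('X^j * q ^+ j.+1)`_k.

Lemma coef_termE (j k : nat) : (j <= k)%N ->
  E j k = 'C(j.+1, k - j)%:R * z ^+ (2 * j + 1 - k) * (1 - z ^+ 2) ^+ (k - j).
Proof.
move=> jk; rewrite /E coefXnM ltnNge jk /= coef_binomial_exp.
by congr (_ * _ ^+ _ * _); lia.
Qed.

Lemma coef_term_small (j k : nat) : (k < j)%N -> E j k = 0.
Proof. by move=> kj; rewrite /E coefXnM kj. Qed.

(** Read off from X * (X^i q^(i+1)) * (X^j q^(j+1)) = X^(i+j+1) q^(i+j+2). *)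
Lemma coef_term_conv (i j k : nat) :
  E (i + j).+1 k.+1 = \sum_(p < k.+1) E i p * E j (k - p)%N.
Proof.
rewrite -coefM; transitivity ('X * ('X^i * q ^+ i.+1 * ('X^j * q ^+ j.+1)))`_k.+1.
  by rewrite /E; congr (nth _ (polyseq _) _); rewrite -addnS -addSn !exprD !exprS; ring.
by rewrite coefXM.
Qed.

Lemma term_sum_widen (k n : nat) : (k < n)%N ->
  \sum_(j < n) c j * E j k = \sum_(j < k.+1) c j * E j k.
Proof.
move=> kn; rewrite (big_ord_widen n (fun j => c j * E j k) kn) [RHS]big_mkcond.
apply: eq_bigr => j _; case: ltnP => // kj.
by rewrite coef_term_small ?mulr0.
Qed.

(** Strong induction: the expansion satisfies the same quadratic recurrence, because the tree counts
    [c] satisfy the Catalan convolution. *)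
Lemma weight_sumE (k : nat) : U k = \sum_(j < k.+1) c j * E j k.
Proof.
elim/ltn_ind: k => -[_|k IH].
  rewrite big_ord1 coef_termE // /U /c /trees /= big_seq1.
  by rewrite !bin0 !mul1r mulr1.
rewrite weight_sumS [RHS]big_ord_recl addrC; congr (_ + _).
  (* The term [j = 0] is a coefficient of q, which has degree at most one, so it matches the
     correction at [k = 0] and vanishes afterwards. *)
  rewrite coef_termE // subn0 /c mul1r.
  case: k {IH} => [|k]; first by rewrite bin1 expr0 !mul1r expr1.
  by rewrite bin_small // !mul0r.
under eq_bigr => i _.
  rewrite !IH ?ltnS ?leq_subr // -1?ltnS //.
  rewrite -(@term_sum_widen i k.+1) //.
  rewrite -(@term_sum_widen (k - i) k.+1) ?ltnS ?leq_subr //.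
  rewrite big_distrlr; over.
rewrite /= exchange_big /=; under eq_bigr => i _ do rewrite exchange_big /=.
transitivity (\sum_(i < k.+1) \sum_(j < k.+1 - i) c i * c j * E (i + j).+1 k.+1).
  apply: eq_bigr => -[i ik] _ /=.
  rewrite (big_ord_widen k.+1 (fun j => c i * c j * E (i + j).+1 k.+1)) ?leq_subr //.
  rewrite [RHS]big_mkcond; apply: eq_bigr => -[j jk] _ /=.
  transitivity (c i * c j * E (i + j).+1 k.+1).
    by rewrite coef_term_conv mulr_sumr; apply: eq_bigr => p _; ring.
  case: ifPn => // ij; rewrite coef_term_small ?mulr0 //; lia.
(* Grouping by m = i + j turns the products c_i c_j into c_(m+1). *)
rewrite -(sum_triangle _ _ (fun i j => c i * c j * E (i + j).+1 k.+1)).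
apply: eq_bigr => m _; rewrite /= /bump add1n /c size_treesS natr_sum mulr_suml.
by apply: eq_bigr => i _; rewrite natrM subnKC // -ltnS.
Qed.

(** Pascal's rule gives C(j+1, m) + 2 C(j+1, m-1) = 2 C(j+2, m) - C(j+1, m), which merges the
    contributions of U_(k+2) and U_(k+1). *)
Lemma one_side_sumE (k : nat) :
  \sum_(t <- trees k.+2) z ^+ one_side_nodes t =
  \sum_(j < k.+3) c j *
    (2 * 'C(j + 2, k.+2 - j)%:R - 'C(j + 1, k.+2 - j)%:R) *
    z ^+ (2 * j + 2 - k.+2) * (1 - z ^+ 2) ^+ (k.+2 - j).
Proof.
rewrite one_side_sumS !weight_sumE big_ord_recr [RHS]big_ord_recr /=.
rewrite mulrDr addrAC; congr (_ + _); last first.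
  rewrite coef_termE // subnn !bin0 !mulr1 mulrCA -mulrA; congr (_ * _).
  by rewrite mul1r -exprS (_ : 2 - 1 = 1) ?mul1r; [congr (_ ^+ _); lia|ring].
rewrite !mulr_sumr -big_split; apply: eq_bigr => -[j jk] _ /=.
rewrite (coef_termE j k.+2) ?(ltnW jk) // (coef_termE j k.+1) //.
(* When the natural subtraction in the exponent truncates, the binomial is zero. *)
have zE : z * ('C(j.+1, k.+2 - j)%:R * z ^+ (2 * j + 1 - k.+2)) =
    'C(j.+1, k.+2 - j)%:R * z ^+ (2 * j + 2 - k.+2).
  have [small|big] := ltnP (2 * j + 1)%N k.+2.
    by rewrite bin_small ?mul0r ?mulr0 //; lia.
  by rewrite mulrCA -exprS; congr (_ * _ ^+ _); lia.
transitivity (c j * (z * ('C(j.+1, k.+2 - j)%:R * z ^+ (2 * j + 1 - k.+2))) *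
    (1 - z ^+ 2) ^+ (k.+2 - j) +
  2 * (1 - z ^+ 2) * (c j * ('C(j.+1, k.+1 - j)%:R * z ^+ (2 * j + 1 - k.+1) *
    (1 - z ^+ 2) ^+ (k.+1 - j)))).
  by ring.
rewrite zE (_ : 2 * j + 1 - k.+1 = 2 * j + 2 - k.+2)%N; last by lia.
rewrite (@subSn j k.+1) // exprS (addn2 j) (addn1 j) (binS j.+1) natrD.
by ring.
Qed.

End GeneratingFunction.

(** * Catalan numbers and expectations over trees *)

Lemma central_binS (m : nat) :
  (m.+1 * 'C(2 * m.+1, m.+1) = 2 * (2 * m).+1 * 'C(2 * m, m))%N.
Proof.
have sym : 'C((2 * m).+1, m.+1) = 'C((2 * m).+1, m).
  by rewrite -bin_sub; [congr binomial; lia|lia].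
have e1 := mul_bin_diag (2 * m).+2 m; have e2 := mul_bin_diag (2 * m).+1 m.
rewrite /= sym in e1 e2; rewrite (mulnS 2 m) -[(2 + _)%N]/(2 * m).+2.
by rewrite -e1; nia.
Qed.

Section Catalan.
Variable F : numFieldType.

Let cb (m : nat) : F := 'C(2 * m, m)%:R.

Lemma catalanS (k : nat) :
  catalan F k.+1 = (4 * k%:R + 2) / (k%:R + 2) * catalan F k.
Proof.
rewrite /catalan; have /(congr1 (fun n : nat => n%:R : F)) := central_binS k.
rewrite !natrM -!natr1 natrM => e.
have k1 : k%:R + 1 != 0 :> F by rewrite natr1 pnatr_eq0.
have k2 : k%:R + 2 != 0 :> F by rewrite -natrD pnatr_eq0 addnC.
apply: (mulfI k1); rewrite [LHS]mulrA e; field.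
by rewrite k1 k2.
Qed.

(* Gosper's telescoping certificate for the Catalan convolution. *)
Let gosper (n j : nat) : F :=
  cb j * cb (n.+1 - j) * (2 * j%:R - n.+1%:R) / (2 * n.+1%:R * n.+2%:R).

Lemma catalan_conv (n : nat) :
  catalan F n.+1 = \sum_(i < n.+1) catalan F i * catalan F (n - i).
Proof.
have S1 m : m%:R + 1 != 0 :> F by rewrite natr1 pnatr_eq0.
have cbS m : cb m.+1 = 2 * (2 * m%:R + 1) / (m%:R + 1) * cb m.
  have /(congr1 (fun n : nat => n%:R : F)) := central_binS m.
  rewrite !natrM -!natr1 natrM => e.
  by apply: (mulfI (S1 m)); rewrite [LHS]e /cb; field.
(* The two boundary values are opposite, and each accounts for half of the Catalan number. *)
transitivity (\sum_(0 <= i < n.+1) (gosper n i.+1 - gosper n i)).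
  rewrite telescope_sumr // /gosper subnn subn0 /cb /catalan muln0 bin0.
  rewrite -!natr1; field.
  by rewrite !natr1 !pnatr_eq0.
rewrite big_mkord; apply: eq_bigr => -[i ik] _ /=.
rewrite /gosper subSS subSn //; set m := (n - i)%N.
have -> : n = (i + m)%N by rewrite /m subnKC.
rewrite !cbS /catalan -!/(cb _) -!natr1 !natrD; field.
by rewrite -natrD !natr1 !pnatr_eq0.
Qed.

Lemma size_trees (k : nat) : (size (trees k))%:R = catalan F k.
Proof.
elim/ltn_ind: k => -[|k] IH; first by rewrite /catalan muln0 bin0 divr1.
rewrite catalan_conv size_treesS natr_sum; apply: eq_bigr => i _.
by rewrite natrM !IH // ltnS leq_subr.
Qed.

Lemma catalan_neq0 (k : nat) : catalan F k != 0.
Proof.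
by rewrite mulf_neq0 ?invr_eq0 ?pnatr_eq0 // -lt0n bin_gt0; lia.
Qed.

Lemma expect_tree (n : nat) (f : nat -> F) : (3 <= n)%N ->
  expect (triangulations n) (fun D => f (one_side_triangles D)) =
  (\sum_(t <- trees (n - 2)) f (one_side_nodes t)) / catalan F (n - 2).
Proof.
case: n => [|[|[|k]]] // _; rewrite /expect -size_trees -sum1_card -sum1_size.
rewrite !(@sum_triangulations k.+2) // ?subSS ?subn0; congr (_ / _).
apply: eq_big_seq => t; rewrite mem_trees => /eqP tk.
by rewrite (@one_side_triangles_tree k.+2).
Qed.

End Catalan.

(** * Probability generating function *)

Lemma pgf_formula (F : numFieldType) (n : nat) (z : F) : (4 <= n)%N ->
  S_pgf n z =
    (catalan F (n - 2))^-1 *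
    \sum_(0 <= j < n.-1)
      catalan F j *
      (2 * 'C(j + 2, n - 2 - j)%:R - 'C(j + 1, n - 2 - j)%:R) *
      z ^ ((2 * j + 4)%N%:Z - n%:Z) *
      (1 - z ^+ 2) ^+ (n - 2 - j).
Proof.
move=> n4; rewrite /S_pgf (expect_tree _ _ (fun s => z ^+ s)) ?(ltnW n4) //.
rewrite mulrC; congr (_ * _).
case: n n4 => [|[|[|[|k]]]] // _; rewrite !subSS subn0 one_side_sumE big_mkord.
apply: eq_bigr => -[j jk] _; rewrite /= size_trees.
(* A negative exponent forces both binomials to vanish; otherwise the integer power is a natural
   one. *)
have [small|big] := ltnP (2 * j + 4)%N k.+4.
  by rewrite !bin_small ?mulr0 ?subr0 ?mulr0 ?mul0r //; lia.
rewrite subzn // (_ : 2 * j + 4 - k.+4 = 2 * j + 2 - k.+2)%N //; lia.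
Qed.

(** * Derivatives at 1 and the first two moments *)

Lemma deriv_exp3_root (F : comNzRingType) (m : nat) (u p : {poly F}) (a : F) :
  u.[a] = 0 ->
  (u ^+ m.+3 * p)^`().[a] = 0 /\ (u ^+ m.+3 * p)^`()^`().[a] = 0.
Proof.
rewrite !exprS -!mulrA; move: (u ^+ m * p) => r ua.
by split; rewrite !(derivM, derivD, hornerD, hornerM) ua; ring.
Qed.

Lemma horner_derivXn (F : comNzRingType) (n : nat) :
  ('X^n : {poly F})^`().[1] = n%:R.
Proof. by rewrite derivXn hornerMn hornerXn expr1n. Qed.

Lemma horner_deriv2Xn (F : comNzRingType) (n : nat) :
  ('X^n : {poly F})^`()^`().[1] = n%:R * (n%:R - 1).
Proof.
rewrite derivXn derivMn derivXn !hornerMn hornerXn expr1n.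
case: n => [|n]; first by rewrite mul0r.
have -> : n.+1%:R - 1 = n%:R :> F by rewrite -natr1 addrK.
by rewrite -mulrnA mulnC natrM.
Qed.

(** The polynomial is grouped by powers of [u], which vanishes at 1, so the cubic part drops out.
    The scalars [a], [b], [d] stand for the coefficients of index k, k + 1, k + 2. *)
Lemma derivs_at_1 (F : comNzRingType) (k : nat) (a b d : F) (H : {poly F}) :
  let u : {poly F} := 1 - 'X^2 in
  let p := u ^+ 3 * H + a *: ('X^k * u ^+ 2) + b *: ('X^(k + 2) * u) +
    d *: 'X^(k + 4) in
  p^`().[1] = d * (k%:R + 4) - 2 * b /\
  p^`()^`().[1] = d * (k%:R + 4) * (k%:R + 3) - b * (4 * k%:R + 10) + 8 * a.
Proof.
move=> u; have u1 : u.[1] = 0 by rewrite hornerD hornerN hornerXn hornerC expr1n subrr.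
have [H1 H2] := deriv_exp3_root F 0 u H 1 u1.
have -> : 'X^k * u ^+ 2 = 'X^k - 2 *: 'X^(k + 2) + 'X^(k + 4).
  by rewrite /u scaler_nat !exprD; ring.
have -> : 'X^(k + 2) * u = 'X^(k + 2) - 'X^(k + 4).
  by rewrite /u !exprD; ring.
split; rewrite !(derivD, derivN, derivZ) !(hornerD, hornerN, hornerZ) ?H1 ?H2.
  by rewrite !horner_derivXn !natrD; ring.
by rewrite !horner_deriv2Xn !natrD; ring.
Qed.

(** These unnormalised factorial moments are the first two derivatives at 1 of the generating
    polynomial [G]. *)
Lemma sum_moments (F : numFieldType) (k : nat) :
  let c := catalan F in let x : F := k%:R in
  let S t : F := (one_side_nodes t)%:R in
  \sum_(t <- trees k.+2) S t = (x + 4) * (c k.+2 - 2 * c k.+1) /\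
  \sum_(t <- trees k.+2) S t * (S t - 1) =
    (x + 4) * ((x + 3) * c k.+2 - (4 * x + 10) * c k.+1 + 4 * (x + 1) * c k).
Proof.
move=> c x S; pose G : {poly F} := \sum_(t <- trees k.+2) 'X ^+ one_side_nodes t.
have G1 : G^`().[1] = \sum_(t <- trees k.+2) S t.
  rewrite raddf_sum horner_sum; apply: eq_bigr => t _; exact: horner_derivXn.
have G2 : G^`()^`().[1] = \sum_(t <- trees k.+2) S t * (S t - 1).
  rewrite !raddf_sum horner_sum; apply: eq_bigr => t _; exact: horner_deriv2Xn.
pose coef j : F := catalan F j *
  (2 * 'C(j + 2, k.+2 - j)%:R - 'C(j + 1, k.+2 - j)%:R).
have coefE j : (size (trees j))%:R *
    (2 * 'C(j + 2, k.+2 - j)%:R - 'C(j + 1, k.+2 - j)%:R) = (coef j)%:P.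
  by rewrite /coef -size_trees polyCM polyCB polyCM !polyC_natr.
(* For [j < k] the exponent [k.+2 - j] is at least 3, and [H] is what remains after removing the
   cube. *)
pose H : {poly F} := \sum_(j < k)
  coef j *: 'X^(2 * j + 2 - k.+2) * (1 - 'X^2) ^+ (k.-1 - j).
have GE : G = (1 - 'X^2) ^+ 3 * H + coef k *: ('X^k * (1 - 'X^2) ^+ 2) +
    coef k.+1 *: ('X^(k + 2) * (1 - 'X^2)) + coef k.+2 *: 'X^(k + 4).
  rewrite /G one_side_sumE !big_ord_recr /= !coefE; congr (_ + _ + _ + _).
  - rewrite mulr_sumr; apply: eq_bigr => -[j jk] _ /=.
    rewrite coefE mul_polyC [RHS]mulrCA -exprD; congr (_ * _ ^+ _); lia.
  - by rewrite mul_polyC scalerAl; congr (_ *: 'X^_ * _ ^+ _); lia.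
  - by rewrite mul_polyC scalerAl subSnn expr1; congr (_ *: 'X^_ * _); lia.
  - by rewrite mul_polyC subnn mulr1; congr (_ *: 'X^_); lia.
have [D1 D2] := derivs_at_1 F k (coef k) (coef k.+1) (coef k.+2) H.
rewrite -G1 -G2 GE D1 D2 /coef -/c -/x.
rewrite subnn subSnn !bin0 !bin1 (_ : k.+2 - k = 2)%N; last by lia.
have bin2k m : 2 * 'C(m.+1, 2)%:R = (m%:R + 1) * m%:R :> F.
  by rewrite -natrM -(mul_bin_diag m.+1 1) bin1 natrM natr1.
split; first by rewrite !natrD -!natr1 -/x; ring.
rewrite (addn2 k) (addn1 k).
(* A factor 2 is moved onto each binomial so that [bin2k] applies without division. *)
have -> (A B : F) : 8 * (c k * (2 * A - B)) = 4 * (c k * (2 * (2 * A) - 2 * B)).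
  by ring.
by rewrite !bin2k !natrD -!natr1 -/x; ring.
Qed.

Lemma mean_formula (F : numFieldType) (n : nat) : (4 <= n)%N ->
  S_mean F n = n%:R * (n%:R - 4) / (2 * n%:R - 5).
Proof.
move=> n4; rewrite /S_mean (expect_tree _ _ (fun s => s%:R)) ?(ltnW n4) //.
case: n n4 => [|[|[|[|k]]]] // _; rewrite !subSS subn0.
have [-> _] := sum_moments F k.
have := catalan_neq0 F k.+1; rewrite (catalanS _ k.+1).
move: (catalan F k.+1) => c c0; rewrite -[k.+4]addn4 -[k.+1]addn1 !natrD.
(* With n = k + 4, each denominator takes this form with a positive constant term, hence is nonzero
   in characteristic zero. *)
have nz a b : a%:R * k%:R + b.+1%:R != 0 :> F.
  by rewrite -natrM -natrD pnatr_eq0 addnS.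
field; rewrite c0 /=; apply/and3P; split.
- by rewrite (_ : _ - _ = 2%:R * k%:R + 3%:R); [exact: nz|ring].
- by rewrite (_ : _ + _ = 1%:R * k%:R + 3%:R); [exact: nz|ring].
- by rewrite (_ : _ + _ = 4%:R * k%:R + 6%:R); [exact: nz|ring].
Qed.

Lemma variance_formula (F : numFieldType) (n : nat) : (4 <= n)%N ->
  S_variance F n =
    2 * n%:R * (n%:R - 1) * (n%:R - 4) * (n%:R - 5) /
    ((2 * n%:R - 5) ^+ 2 * (2 * n%:R - 7)).
Proof.
move=> n4; rewrite /S_variance /variance -/(S_mean F n) mean_formula //.
set m := _ / _.
rewrite (expect_tree _ _ (fun s => (s%:R - m) ^+ 2)) ?(ltnW n4) //.
rewrite {}/m.
case: n n4 => [|[|[|[|k]]]] // _; rewrite !subSS subn0.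
have [M1 M2] := sum_moments F k.
set m := _ / (2 * _ - 5).
(* From (S - m)^2 = S (S - 1) + (1 - 2 m) S + m^2, where the constant is summed over a Catalan
   number of trees. *)
have -> : \sum_(t <- trees k.+2) ((one_side_nodes t)%:R - m) ^+ 2 =
    \sum_(t <- trees k.+2) (one_side_nodes t)%:R * ((one_side_nodes t)%:R - 1) +
    (1 - 2 * m) * \sum_(t <- trees k.+2) (one_side_nodes t)%:R +
    m ^+ 2 * catalan F k.+2.
  rewrite -size_trees -sum1_size natr_sum !mulr_sumr -!big_split.
  by apply: eq_bigr => t _ /=; ring.
rewrite M1 M2 {}/m !(catalanS _ k.+1) (catalanS _ k).
rewrite -[k.+4]addn4 -[k.+1]addn1 !natrD.
have nz a b : a%:R * k%:R + b.+1%:R != 0 :> F.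
  by rewrite -natrM -natrD pnatr_eq0 addnS.
have := catalan_neq0 F k; move: (catalan F k) => c c0.
field; rewrite c0 /=; apply/and5P; split; last (apply/andP; split).
- by rewrite (_ : _ - _ = 2%:R * k%:R + 1%:R); [exact: nz|ring].
- by rewrite (_ : _ - _ = 2%:R * k%:R + 3%:R); [exact: nz|ring].
- by rewrite (_ : _ + _ = 1%:R * k%:R + 2%:R); [exact: nz|ring].
- by rewrite (_ : _ + _ = 1%:R * k%:R + 3%:R); [exact: nz|ring].
- exact: nz.
- by rewrite (_ : _ + _ = 4%:R * k%:R + 6%:R); [exact: nz|ring].
Qed.

(* The exponent 2j+4-n is an integer power: when it is negative, the bracket *)
(* vanishes and the term is 0. *)
Theorem lemma2 (R : realType) :
  (forall (n : nat) (z : R[i]), (4 <= n)%N ->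
     S_pgf n z =
       (catalan R[i] (n - 2))^-1 *
       \sum_(0 <= j < n.-1)
          catalan R[i] j *
          (2 * 'C(j + 2, n - 2 - j)%:R - 'C(j + 1, n - 2 - j)%:R) *
          z ^ ((2 * j + 4)%N%:Z - n%:Z) *
          (1 - z ^+ 2) ^+ (n - 2 - j)) /\
  (forall n : nat, (4 <= n)%N ->
     S_mean R n = n%:R * (n%:R - 4) / (2 * n%:R - 5)) /\
  (forall n : nat, (5 <= n)%N ->
     S_variance R n =
       2 * n%:R * (n%:R - 1) * (n%:R - 4) * (n%:R - 5) /
       ((2 * n%:R - 5) ^+ 2 * (2 * n%:R - 7))).
Proof.
split; first by move=> n z; apply: pgf_formula.
split; first exact: mean_formula.
by move=> n n5; apply: variance_formula; apply: ltnW.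
Qed.
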